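(* If $L$ is a non-abelian $3$-dimensional IAC algebra over a field $\mathbb F$ of characteristic different from $2$, then $L$ is a simple Lie algebra and $\mathrm{Aut}(L)\cong\mathsf{SO}(3,\mathbb F)$, where $\mathsf{SO}(3,\mathbb F)$ denotes the special orthogonal group of some non-degenerate symmetric bilinear form on a $3$-dimensional vector space over $\mathbb F$ (the form depending on $L$).
   Context: An anti-commutative algebra over a field is a (not necessarily associative) algebra, with product written $\llbracket x,y\rrbracket$, satisfying $\llbracket x,x\rrbracket=0$ for all $x$. It is IAC if in addition its automorphism group $\mathrm{Aut}(L)$ acts irreducibly on the vector space $L$. The algebra is abelian if all products are zero. *)

(* Defs.v *)
From HB Require Import structures.
From mathcomp Require Import all_boot all_order all_algebra.
From mathcomp Require Import boolp.

Set Implicit Arguments.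
Unset Strict Implicit.
Unset Printing Implicit Defensive.

Import GRing.Theory.
Local Open Scope ring_scope.

Definition GL (F : fieldType) (V : vectType F) : predArgType :=
  {f : 'End(V) | lker f == 0%VS}.

Section GeneralLinearGroup.
Context {F : fieldType} {V : vectType F}.
Implicit Types f g h : GL V.

HB.instance Definition _ := SubChoice.on (GL V).

Fact GL1_subproof : lker (\1%VF : 'End(V)) == 0%VS.
Proof. by apply/lker0P => x y; rewrite !id_lfunE. Qed.

Fact GLM_subproof f g : lker (val f \o val g)%VF == 0%VS.
Proof.
apply/lker0P => x y; rewrite !comp_lfunE.
by move=> /(lker0P (valP f)) /(lker0P (valP g)).
Qed.

Fact GLV_subproof f : lker (val f)^-1%VF == 0%VS.
Proof. by apply/lker0P; apply: can_inj (lker0_lfunVK (valP f)). Qed.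

Definition GL_one : GL V := Sub \1%VF GL1_subproof.
Definition GL_mul f g : GL V := Sub (val f \o val g)%VF (GLM_subproof f g).
Definition GL_inv f : GL V := Sub (val f)^-1%VF (GLV_subproof f).

Fact GL_mulA : associative GL_mul.
Proof. by move=> f g h; apply/val_inj; rewrite /= comp_lfunA. Qed.
Fact GL_mul1 : left_id GL_one GL_mul.
Proof. by move=> f; apply/val_inj; rewrite /= comp_lfun1l. Qed.
Fact GL_mulr1 : right_id GL_one GL_mul.
Proof. by move=> f; apply/val_inj; rewrite /= comp_lfun1r. Qed.
Fact GL_mulV : left_inverse GL_one GL_inv GL_mul.
Proof. by move=> f; apply/val_inj; rewrite /= (lker0_compVf (valP f)). Qed.
Fact GL_mulrV : right_inverse GL_one GL_inv GL_mul.
Proof. by move=> f; apply/val_inj; rewrite /= (lker0_compfV (valP f)). Qed.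

HB.instance Definition _ :=
  isGroup.Build (GL V) GL_mulA GL_mul1 GL_mulr1 GL_mulV GL_mulrV.

End GeneralLinearGroup.

Definition GL_fun (F : fieldType) (V : vectType F) (f : GL V) : V -> V := val f.
Coercion GL_fun : GL >-> Funclass.

Section GLTheory.
Context {F : fieldType} {V : vectType F}.
Implicit Types f g : GL V.

Lemma GL_1E (x : V) : (1%g : GL V) x = x.
Proof. exact: id_lfunE. Qed.
Lemma GL_ME f g x : ((f * g)%g : GL V) x = f (g x).
Proof. exact: comp_lfunE. Qed.
Lemma GL_VK f x : f ((f^-1%g : GL V) x) = x.
Proof. by rewrite -GL_ME mulgV GL_1E. Qed.

End GLTheory.

(* A (not necessarily associative) algebra structure on L is its product,
   a bilinear map br : L -> L -> L. *)
Section Algebras.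
Variables (F : fieldType) (L : vectType F).
Implicit Types (br : {bilinear L -> L -> L}) (U : {vspace L}).

Definition anticommutative br : Prop := forall x : L, br x x = 0.

Definition abelian_alg br : Prop := forall x y : L, br x y = 0.

Definition jacobi br : Prop := forall x y z : L,
  br x (br y z) + br y (br z x) + br z (br x y) = 0.

Definition lie_algebra br : Prop := anticommutative br /\ jacobi br.

Definition ideal_of br U : Prop :=
  forall x u : L, u \in U -> br x u \in U /\ br u x \in U.

Definition simple_alg br : Prop :=
  ~ abelian_alg br /\
  forall U, ideal_of br U -> U = 0%VS \/ U = fullv.

Definition aut_pred br : pred (GL L) :=
  fun g => `[< forall x y : L, g (br x y) = br (g x) (g y) >].

Definition Aut br : predArgType := {g : GL L | aut_pred br g}.

Definition acts_irreducibly_on_space br : Prop :=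
  (fullv : {vspace L}) <> 0%VS /\
  forall U, (forall (g : Aut br) (u : L), u \in U -> val g u \in U) ->
    U = 0%VS \/ U = fullv.

Definition IAC br : Prop := anticommutative br /\ acts_irreducibly_on_space br.

Fact aut_group_closed br : group_closed (aut_pred br).
Proof.
split; first by apply/asboolP => x y; rewrite !GL_1E.
move=> f g /asboolP fP /asboolP gP; apply/asboolP => x y.
rewrite !GL_ME -fP; congr (GL_fun f _).
by apply: (lker0P (valP g)); rewrite [LHS]GL_VK [RHS]gP !GL_VK.
Qed.

HB.instance Definition _ br := SubChoice.on (Aut br).
HB.instance Definition _ br :=
  SubChoice_isSubGroup.Build (GL L) (aut_pred br) (Aut br)
    (aut_group_closed br).

End Algebras.

Section SpecialOrthogonalGroup.
Variables (F : fieldType) (V : vectType F).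
Implicit Types (b : {symmetric V}).

(* The determinant of the matrix of f in the basis vbasis {:V}; it does not
   depend on the basis. *)
Definition det_lfun (f : 'End(V)) : F :=
  \det (passmx.mxof (vbasis {:V}) (vbasis {:V}) f).

Lemma det_lfun1 : det_lfun \1%VF = 1.
Proof.
by rewrite /det_lfun passmx.mxof1 ?det1 // (basis_free (vbasisP _)).
Qed.

Lemma det_lfunM (f g : 'End(V)) :
  det_lfun (f \o g)%VF = det_lfun f * det_lfun g.
Proof.
by rewrite /det_lfun (passmx.mxof_comp _ _ (vbasisP {:V})) det_mulmx mulrC.
Qed.

Definition so_pred b : pred (GL V) :=
  fun g => `[< isometry b b g >] && (det_lfun (val g) == 1).

Definition SO b : predArgType := {g : GL V | so_pred b g}.

Fact so_group_closed b : group_closed (so_pred b).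
Proof.
split.
  apply/andP; split; first by apply/asboolP => x y; rewrite !GL_1E.
  by apply/eqP; exact: det_lfun1.
move=> f g /andP[/asboolP fP /eqP f1] /andP[/asboolP gP /eqP g1].
apply/andP; split.
  by apply/asboolP => x y; rewrite !GL_ME fP -gP !GL_VK.
have := det_lfunM (val g) (val g)^-1%VF.
rewrite (lker0_compfV (valP g)) det_lfun1 g1 mul1r => gV1.
by rewrite [val _]/= det_lfunM f1 mul1r -gV1.
Qed.

HB.instance Definition _ b := SubChoice.on (SO b).
HB.instance Definition _ b :=
  SubChoice_isSubGroup.Build (GL V) (so_pred b) (SO b) (so_group_closed b).

End SpecialOrthogonalGroup.

Definition group_isomorphic (G H : groupType) : Prop :=
  exists phi : {multiplicative G -> H}, bijective phi.

(* Main.v *)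
From HB Require Import structures.
Require Import Defs.
From mathcomp Require Import all_boot all_order all_algebra ring.
From mathcomp Require Import boolp.

(* In coordinates an anti-commutative product on F^3 is [x, y] = (x * y) A with
   * the cross product and A a 3x3 matrix. Since (xg * yg) g^T = det(g) (x * y),
   an invertible g is an automorphism iff g^T A g = det(g) A. The same relation
   then holds for K = A - A^T, and any matrix C satisfying it for all
   automorphisms g has an Aut-invariant row space, hence is 0 or invertible.
   As K is skew of odd size in characteristic not 2, it is singular, so K = 0;
   A itself is nonzero, hence symmetric and invertible. Taking determinants,
   automorphisms have determinant 1, so they are the elements of determinant 1
   preserving b(x, y) = x A^-1 y^T. Finally the formula
   u * (v * w) = (u.w) v - (u.v) w becomes
   [x, [y, z]] = det(A) (b(x, z) y - b(x, y) z), which gives the Jacobi identity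
   by symmetry of b and simplicity by its nondegeneracy. *)

Set Implicit Arguments.
Unset Strict Implicit.
Unset Printing Implicit Defensive.

Import GRing.Theory passmx.
Local Open Scope ring_scope.

(** * Explicit formulas for indices and determinants in size three *)

Lemma big_ord3 (V : nmodType) (E : 'I_3 -> V) : \sum_i E i = E 0 + E 1 + E 2.
Proof.
rewrite !big_ord_recr big_ord0 /= Monoid.simpm.
by congr (E _ + E _ + E _); apply/val_inj.
Qed.

Lemma forall_ord3 (P : 'I_3 -> Prop) : P 0 -> P 1 -> P 2 -> forall i, P i.
Proof.
move=> P0 P1 P2 [[|[|[|//]]] lt_i3].
- by rewrite (_ : Ordinal _ = 0) //; apply/val_inj.
- by rewrite (_ : Ordinal _ = 1) //; apply/val_inj.
- by rewrite (_ : Ordinal _ = 2) //; apply/val_inj.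
Qed.

Lemma det_mx33 (R : comNzRingType) (g : 'M[R]_3) : \det g =
  g 0 0 * (g 1 1 * g 2 2 - g 1 2 * g 2 1)
  - g 0 1 * (g 1 0 * g 2 2 - g 1 2 * g 2 0)
  + g 0 2 * (g 1 0 * g 2 1 - g 1 1 * g 2 0).
Proof.
(* Indexing the entries by naturals lets the lifted ordinals produced by the expansions compute to
   numerals, so that [ring] can identify equal entries. *)
pose f m n := g (inord m) (inord n).
have gE i j : g i j = f i j by rewrite /f !inord_val.
rewrite (expand_det_row _ 0) big_ord3 /cofactor.
rewrite !(expand_det_row _ 0) !big_ord_recr !big_ord0 /= /cofactor.
rewrite !det_mx11 !mxE !gE /= /bump /=.
ring.
Qed.

Definition dot (R : pzSemiRingType) n (u v : 'rV[R]_n) : R := (u *m v^T) 0 0.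

(** * Cross products and their behaviour under matrices *)

Section Cross.
Variable F : fieldType.
Implicit Types (u v w : 'rV[F]_3) (g A : 'M[F]_3).

(** Addition in ['I_3] is modulo 3, so one cyclic formula covers all three coordinates. *)
Definition cross u v : 'rV[F]_3 :=
  \row_k (u 0 (k + 1) * v 0 (k + 2) - u 0 (k + 2) * v 0 (k + 1)).

Lemma ord3D : (((1 + 1)%R = 2%R :> 'I_3) * ((1 + 2)%R = 0%R :> 'I_3) *
  ((2 + 1)%R = 0%R :> 'I_3) * ((2 + 2)%R = 1%R :> 'I_3) *
  ((0 + 1)%R = 1%R :> 'I_3) * ((0 + 2)%R = 2%R :> 'I_3))%type.
Proof. by do !split; apply/val_inj. Qed.

(** Paired with a third vector [w], this is det(ug, vg, wg) = det(g) det(u, v, w). *)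
Lemma cross_mul g u v :
  cross (u *m g) (v *m g) *m g^T = \det g *: cross u v.
Proof.
apply/rowP; apply: forall_ord3;
  by rewrite det_mx33 !mxE !big_ord3 !mxE !ord3D !big_ord3; ring.
Qed.

Lemma cross_delta k :
  cross (delta_mx 0 (k + 1)) (delta_mx 0 (k + 2)) = delta_mx 0 k.
Proof.
apply/rowP; move: k; apply: forall_ord3; apply: forall_ord3;
  by rewrite !mxE !ord3D /=; ring.
Qed.

Lemma cross_cross u v w : cross u (cross v w) = dot u w *: v - dot u v *: w.
Proof.
apply/rowP; apply: forall_ord3;
  by rewrite /dot !mxE !big_ord3 !mxE !ord3D; ring.
Qed.

Lemma crossE (U V : lmodType F) (f : {bilinear U -> U -> V}) (e : 'I_3 -> U)
    u v :
  (forall x, f x x = 0) ->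
  f (\sum_i u 0 i *: e i) (\sum_i v 0 i *: e i) =
    \sum_k cross u v 0 k *: f (e (k + 1)) (e (k + 2)).
Proof.
move=> f0.
have fC x y : f x y = - f y x.
  apply/eqP; rewrite -addr_eq0; move: (f0 (x + y)).
  by rewrite linearDl !linearDr /= !f0 add0r addr0 => ->.
rewrite !big_ord3 !mxE !ord3D.
rewrite !(linearDl, linearDr, linearZl_LR, linearZr_LR) /= !f0.
(* Only the anti-cyclic products are flipped; each then merges with its cyclic partner into one
   coordinate of the cross product. *)
rewrite (fC (e 1) (e 0)) (fC (e 2) (e 1)) (fC (e 0) (e 2)).
rewrite !scalerN !scaler0 !scalerBl !scalerA.
by rewrite add0r !addr0 !addrA [LHS](ACl (4*6*5*2*1*3)).
Qed.

Lemma cross_mulmx_eqP A g : g \in unitmx ->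
  (forall u v, cross u v *m A *m g = cross (u *m g) (v *m g) *m A) <->
  g^T *m A *m g = \det g *: A.
Proof.
move=> gU; have gTU : g^T \in unitmx by rewrite unitmx_tr.
have crossg u v : cross (u *m g) (v *m g) = \det g *: (cross u v *m invmx g^T).
  by rewrite scalemxAl -cross_mul mulmxK.
split=> [Ag | gAg u v]; last first.
  by rewrite crossg -scalemxAl scalemxAr -gAg -!mulmxA mulKmx.
have -> : \det g *: A = g^T *m (\det g *: (invmx g^T *m A)).
  by rewrite -scalemxAr mulKVmx.
(* Each standard basis vector is the cross product of the other two, so the identity on cross
   products determines every row. *)
rewrite -mulmxA; congr (_ *m _); apply/row_matrixP => k.
rewrite !rowE -cross_delta mulmxA Ag crossg.
by rewrite -!scalemxAl -scalemxAr mulmxA.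
Qed.

(** In size three, determinants give det(g)^2 det(A) = det(g)^3 det(A), hence det(g) = 1; inverting
    g^T A g = A then gives the relation for A^-1. *)
Lemma conj_similitude_det A g : A \in unitmx -> g \in unitmx ->
  g^T *m A *m g = \det g *: A <->
  g *m invmx A *m g^T = invmx A /\ \det g = 1.
Proof.
move=> AU gU; have gTU : g^T \in unitmx by rewrite unitmx_tr.
have dA : \det A != 0 by rewrite -unitfE -unitmxE.
have dg : \det g != 0 by rewrite -unitfE -unitmxE.
have equiv1 : g^T *m A *m g = A <-> g *m invmx A *m g^T = invmx A.
  split=> [gAg | gBg].
    have <- : g *m invmx A *m (g^T *m A *m g) *m invmx g *m invmx A
              = g *m invmx A *m g^T by rewrite !mulmxA !mulmxK.
    by rewrite gAg mulmxKV // mulmxV // mul1mx.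
  have <- : g^T *m A *m (g *m invmx A *m g^T) *m invmx g^T *m A
            = g^T *m A *m g by rewrite !mulmxA mulmxK // mulmxKV.
  by rewrite gBg mulmxK // mulmxV // mul1mx.
split=> [gAg | [/equiv1-> ->]]; last by rewrite scale1r.
suff dg1 : \det g = 1 by split=> //; apply/equiv1; rewrite gAg dg1 scale1r.
have := congr1 determinant gAg; rewrite !det_mulmx det_tr detZ.
move=> detE; apply: (mulfI (mulf_neq0 (mulf_neq0 dg dg) dA)); rewrite mulr1.
by rewrite [RHS]mulrAC detE; ring.
Qed.

End Cross.

(** * Coordinates, and symmetric forms given by matrices *)

Lemma coordinates (F : fieldType) (V : vectType F) (n : nat) :
  \dim {:V} = n ->
  exists (c : {linear V -> 'rV[F]_n}) (d : {linear 'rV[F]_n -> V})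
    (M : 'End(V) -> 'M[F]_n),
  [/\ cancel c d, cancel d c,
      forall (f : 'End(V)) x, c (f x) = c x *m M f &
      forall f, det_lfun f = \det (M f)].
Proof.
(* This basis also defines [det_lfun], so the determinant clause holds by definition. *)
move=> <-; pose e := vbasis {:V}; have eb : basis_of fullv e := vbasisP _.
exists [the {linear _ -> _} of rVof e],
  [the {linear _ -> _} of vecof e], (mxof e e); split=> //.
- exact: (rVofK eb).
- exact: (vecofK eb).
- exact: (rVof_app e eb).
Qed.

Lemma symmetric_form_of_mx (F : fieldType) (V : vectType F) (n : nat)
    (c : {linear V -> 'rV[F]_n}) (B : 'M[F]_n) : B^T = B ->
  exists b : {symmetric V}, forall x y, b x y = dot (c x *m B) (c y).
Proof.
move=> BT; pose b x y := dot (c x *m B) (c y).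
have b_bilinear : bilinear_for *%R (idfun \; *%R) b.
  split=> z a x y; rewrite /b /dot linearP /=.
    by rewrite !mulmxDl -!scalemxAl !mxE.
  by rewrite linearP mulmxDr -scalemxAr !mxE.
have b_sym x y : b x y = (-1) ^+ false * idfun (b y x).
  rewrite mul1r /b /dot /= -[in RHS]BT.
  suff -> : c y *m B^T *m (c x)^T = (c x *m B *m (c y)^T)^T by rewrite [RHS]mxE.
  by rewrite !trmx_mul trmxK mulmxA.
pose b1 := bilinear_isBilinear.Build F V V F *%R (idfun \; *%R) b b_bilinear.
pose b2 := isHermitianSesquilinear.Build F V false idfun b b_sym.
pose bb : {symmetric V} := HB.pack b b1 b2.
by exists bb.
Qed.


(** * Consequences of the double bracket formula and of irreducibility *)

Section BilinearAlgebra.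
Variables (F : fieldType) (L : vectType F) (br : {bilinear L -> L -> L}).

Lemma double_bracket_jacobi (a : F) (b : {symmetric L}) :
  (forall x y z, br x (br y z) = a *: (b x z *: y - b x y *: z)) -> jacobi br.
Proof.
move=> brbr x y z; have bC u v : b u v = b v u by rewrite hermC mul1r.
rewrite !brbr -!scalerDr (bC y x) (bC z y) (bC z x).
rewrite (_ : _ + _ = 0) ?scaler0 //.
by rewrite !addrA !subrK subrr.
Qed.

(** For a nonzero u in U, choose v with b(v, u) nonzero: [v, [y, u]] lies in U and is a nonzero
    multiple of y modulo u, so every y lies in U. *)
Lemma double_bracket_ideal (a : F) (b : {symmetric L}) (U : {vspace L}) :
  a != 0 -> nondegenerate b ->
  (forall x y z, br x (br y z) = a *: (b x z *: y - b x y *: z)) ->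
  ideal_of br U -> U = 0%VS \/ U = fullv.
Proof.
move=> a0 b_nondeg brbr idU; have [->|U0] := eqVneq U 0%VS; [by left | right].
have uU := memv_pick U; set u := vpick U in uU.
have u0 : u != 0 by rewrite vpick0.
have /mem_orthovPn[v _ buv] : u \notin orthov b fullv.
  by rewrite (eqP b_nondeg) memv0.
apply/eqP; rewrite eqEsubv subvf; apply/subvP => y _.
have bvu : a * b v u != 0 by rewrite mulf_neq0 // hermC mul1r.
have := (idU v _ (idU y u uU).1).1.
rewrite brbr scalerBr !scalerA rpredBr => [avuy|]; last exact: rpredZ.
by rewrite -[y](scalerK bvu); apply: rpredZ.
Qed.

Variables (n : nat) (c : {linear L -> 'rV[F]_n}) (d : {linear 'rV[F]_n -> L}).
Hypotheses (cK : cancel c d) (dK : cancel d c).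

Lemma irreducible_row_space (M : 'End(L) -> 'M[F]_n) (C : 'M[F]_n) :
  (forall (f : 'End(L)) x, c (f x) = c x *m M f) ->
  acts_irreducibly_on_space br ->
  (forall g : Aut br, exists D, C *m M (val (val g)) = D *m C) ->
  C = 0 \/ C \in unitmx.
Proof.
move=> cM [_ irr] CM; pose U := limg (linfun (d \o mulmxr C \o c)).
have UP x : reflect (exists u, c x = u *m C) (x \in U).
  apply: (iffP memv_imgP) => [[y _ ->] | [u cx]].
    by exists (c y); rewrite lfunE /= dK.
  by exists (d u); rewrite ?memvf // lfunE /= dK -cx cK.
have [g u /UP[v cu] | U0 | Uf] := irr U.
- have [D CD] := CM g; apply/UP; exists (v *m D).
  by rewrite cM cu -!mulmxA -CD.
- left; apply/row_matrixP => i; rewrite rowE linear0.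
  have /UP : exists v, c (d (delta_mx 0 i *m C)) = v *m C.
    by exists (delta_mx 0 i); rewrite dK.
  by rewrite U0 memv0 => /eqP/(congr1 c); rewrite dK linear0.
- right; rewrite -row_full_unit -sub1mx; apply/row_subP => i.
  have /UP[v] : d (row i 1%:M) \in U by rewrite Uf memvf.
  by rewrite dK => ->; apply: submxMl.
Qed.

End BilinearAlgebra.


(** * The structure matrix, its automorphisms and its form *)

Section ThreeDimensional.
Variables (F : fieldType) (L : vectType F) (br : {bilinear L -> L -> L}).
Variables (c : {linear L -> 'rV[F]_3}) (d : {linear 'rV[F]_3 -> L}).
Hypotheses (cK : cancel c d) (dK : cancel d c).

Lemma structure_matrix : anticommutative br ->
  exists A : 'M[F]_3, forall x y, c (br x y) = cross (c x) (c y) *m A.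
Proof.
move=> br0; pose e i := d (delta_mx 0 i).
exists (\matrix_k c (br (e (k + 1)) (e (k + 2)))) => x y.
have dE x' : x' = \sum_i c x' 0 i *: e i.
  rewrite -{1}[x']cK {1}[c x']row_sum_delta linear_sum.
  by apply: eq_bigr => i _; rewrite linearZ.
rewrite {1}[x]dE {1}[y]dE crossE // linear_sum mulmx_sum_row.
by apply: eq_bigr => i _; rewrite linearZ rowK.
Qed.

Variables (M : 'End(L) -> 'M[F]_3) (A : 'M[F]_3).
Hypothesis cM : forall (f : 'End(L)) x, c (f x) = c x *m M f.
Hypothesis det_M : forall f, det_lfun f = \det (M f).
Hypothesis cbr : forall x y, c (br x y) = cross (c x) (c y) *m A.

Lemma GL_unitmx (g : GL L) : M (val g) \in unitmx.
Proof.
rewrite unitmxE -det_M; apply/unitrPr; exists (det_lfun (val g^-1%g)).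
by rewrite -det_lfunM (lker0_compfV (valP g)) det_lfun1.
Qed.

Lemma aut_predE (g : GL L) : aut_pred br g <->
  (M (val g))^T *m A *m M (val g) = \det (M (val g)) *: A.
Proof.
rewrite -(cross_mulmx_eqP A (GL_unitmx g)).
split=> [/asboolP gbr u v | gcross].
  have := congr1 c (gbr (d u) (d v)).
  by rewrite /GL_fun cM !cbr !cM !dK.
apply/asboolP => x y; apply: (can_inj cK).
by rewrite /GL_fun cM !cbr !cM gcross.
Qed.

(** The relation rewrites as C g = D C with D = det(g) (g^T)^-1, which is what invariance of the row
    space requires. *)
Lemma aut_similitude (C : 'M[F]_3) :
  (forall g : GL L, aut_pred br g ->
    (M (val g))^T *m C *m M (val g) = \det (M (val g)) *: C) ->
  acts_irreducibly_on_space br -> C = 0 \/ C \in unitmx.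
Proof.
move=> gC irr; apply: (irreducible_row_space cK dK cM irr) => g.
have gTU : (M (val (val g)))^T \in unitmx by rewrite unitmx_tr GL_unitmx.
exists (\det (M (val (val g))) *: invmx (M (val (val g)))^T).
by rewrite -scalemxAl scalemxAr -(gC _ (valP g)) -!mulmxA mulKmx.
Qed.

Lemma structure_matrix_sym :
  2%N \notin [pchar F] -> acts_irreducibly_on_space br -> A^T = A.
Proof.
move=> char2 irr; pose K := A - A^T.
have [|K0|] := @aut_similitude K _ irr; last 2 first.
- by apply/esym/eqP; rewrite -subr_eq0 -/K K0.
- have KT : K^T = - K by rewrite /K linearB /= trmxK opprB.
  rewrite unitmxE unitfE; case/eqP; apply/eqP.
  have := det_tr K; rewrite KT -scaleN1r detZ => /eqP.
  (* Since (-1)^3 = -1, the equation becomes 2 det(K) = 0. *)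
  rewrite exprS sqrrN expr1n mulr1 mulN1r eq_sym -addr_eq0.
  rewrite -mulr2n -mulr_natl mulf_eq0; case/orP => // two0.
  by case/negP: char2; rewrite inE.
- move=> g /aut_predE gA; have := congr1 trmx gA.
  rewrite linearZ /= !trmx_mul trmxK mulmxA => gAT.
  by rewrite /K mulmxBr mulmxBl gA gAT scalerBr.
Qed.

Lemma structure_matrix_unit :
  ~ abelian_alg br -> acts_irreducibly_on_space br -> A \in unitmx.
Proof.
move=> nab irr; have [|A0|//] := @aut_similitude A _ irr.
  by move=> g /aut_predE.
case: nab => x y; apply: (can_inj cK).
by rewrite cbr A0 mulmx0 linear0.
Qed.

Hypotheses (A_unit : A \in unitmx) (A_sym : A^T = A).

(** As A is symmetric, (u * v) A = det(A) (u A^-1 * v A^-1); applied to the outer bracket, its A^-1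
    cancels the A of the inner one and leaves a double cross product. *)
Lemma double_bracket x y z : br x (br y z) =
  \det A *: (dot (c x *m invmx A) (c z) *: y
             - dot (c x *m invmx A) (c y) *: z).
Proof.
have crossA u v :
    cross u v *m A = \det A *: cross (u *m invmx A) (v *m invmx A).
  by rewrite -cross_mul !mulmxKV // A_sym.
apply: (can_inj cK); rewrite cbr crossA cbr mulmxK // cross_cross.
by rewrite [RHS]linearZ [c (_ - _)]linearB ![c (_ *: _)]linearZ.
Qed.

Variable b : {symmetric L}.
Hypothesis bE : forall x y, b x y = dot (c x *m invmx A) (c y).

Lemma structure_form_nondegenerate : nondegenerate b.
Proof.
rewrite /nondegenerate -subv0; apply/subvP => x /mem_orthovP xP.
rewrite memv0 -(inj_eq (can_inj cK)) linear0.
suff /eqP cA : c x *m invmx A = 0.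
  by rewrite -[c x](mulmxKV A_unit) (eqP cA) mul0mx.
apply/rowP => k; have := xP (d (delta_mx 0 k)) (memvf _).
by rewrite bE dK /dot trmx_delta -colE !mxE.
Qed.

Lemma aut_pred_so (g : GL L) : aut_pred br g = so_pred b g.
Proof.
have isoP : `[< isometry b b g >] <->
    M (val g) *m invmx A *m (M (val g))^T = invmx A.
  have bg x y : b (g x) (g y) =
      dot (c x *m (M (val g) *m invmx A *m (M (val g))^T)) (c y).
    by rewrite bE /GL_fun !cM /dot trmx_mul !mulmxA.
  split=> [/asboolP gb | gA].
    apply/matrixP => i j.
    (* Evaluating on two basis vectors reads off the entry at (i, j). *)
    have := gb (d (delta_mx 0 i)) (d (delta_mx 0 j)).
    rewrite bg bE !dK /dot trmx_delta -!rowE -!colE.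
    by rewrite ![col _ _ _ _]mxE ![row _ _ _ _]mxE.
  by apply/asboolP => x y; rewrite bg gA bE.
apply/idP/idP.
  move/aut_predE/(conj_similitude_det A_unit (GL_unitmx g)) => [gA g1].
  by apply/andP; split; [apply/isoP | rewrite det_M g1].
case/andP => /isoP gA /eqP g1; apply/aut_predE.
by apply/(conj_similitude_det A_unit (GL_unitmx g)); rewrite -det_M.
Qed.

(** Both groups are cut out of [GL L] by the same predicate, so the isomorphism is the identity on
    underlying maps. *)
Lemma Aut_isomorphic_SO : group_isomorphic (Aut br) (SO b).
Proof.
pose phi (g : Aut br) : SO b :=
  Sub (val g) (etrans (esym (aut_pred_so _)) (valP g)).
pose psi (g : SO b) : Aut br :=
  Sub (val g) (etrans (aut_pred_so _) (valP g)).
have phiM : {morph phi : x y / (x * y)%g >-> (x * y)%g}.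
  by move=> x y; apply/val_inj.
pose phi_mul : {multiplicative Aut br -> SO b} :=
  HB.pack phi (isMultiplicative.Build _ _ phi phiM).
by exists phi_mul, psi => g; apply/val_inj.
Qed.

End ThreeDimensional.

Theorem proposition5p1 (F : fieldType) (L : vectType F)
    (br : {bilinear L -> L -> L}) :
  2%N \notin [pchar F] ->
  \dim {:L} = 3%N ->
  IAC br ->
  ~ abelian_alg br ->
  lie_algebra br /\ simple_alg br /\
  exists (V : vectType F) (b : {symmetric V}),
    [/\ \dim {:V} = 3%N, nondegenerate b & group_isomorphic (Aut br) (SO b)].
Proof.
move=> char2 dimL [br0 irr] nab.
have [c [d [M [cK dK cM det_M]]]] := coordinates dimL.
have [A cbr] := structure_matrix cK br0.
have A_sym := structure_matrix_sym cK dK cM det_M cbr char2 irr.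
have A_unit := structure_matrix_unit cK dK cM det_M cbr nab irr.
(* Maps act on row vectors from the right, so isometries satisfy g B g^T = B; automorphisms satisfy
   this for B = A^-1. *)
have [b bE] : exists b : {symmetric L},
    forall x y, b x y = dot (c x *m invmx A) (c y).
  by apply: symmetric_form_of_mx; rewrite trmx_inv A_sym.
have b_nondeg := structure_form_nondegenerate cK dK A_unit bE.
have brbr x y z : br x (br y z) = \det A *: (b x z *: y - b x y *: z).
  by rewrite !bE (double_bracket cK cbr).
split; first by split=> //; apply: double_bracket_jacobi brbr.
split; first split=> // U.
  by apply: (double_bracket_ideal _ b_nondeg brbr); rewrite -unitfE -unitmxE.
exists L, b; split=> //.
exact: (Aut_isomorphic_SO cK dK cM det_M cbr A_unit bE).
Qed.
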